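(* Let $G=(V,E)$ be a Laman-sparse graph on $n$ vertices and let $p=(p_1,\dots,p_n)$ be a generic configuration in $\mathbb{R}^2$, with $d_E=(\|p_i-p_j\|^2)_{ij\in E}$. Then the EDM completion system $\{X\in\mathcal{S}^n_+:\Pi_E(K(X))=d_E,\ Xe=0\}$ has singularity degree $0$; equivalently, $(G,p)$ has no nonzero positive semidefinite equilibrium stress matrix, and there is a feasible $X$ with $X\succeq0$, $Xe=0$, $\operatorname{rank}X=n-1$, i.e., a configuration $\bar p$ with affine span of dimension $n-1$ satisfying $\|\bar p_i-\bar p_j\|^2=d_{ij}$ for all $ij\in E$.
   Context: Laman-sparse: every subgraph with $k\ge 2$ vertices has at most $2k-3$ edges. Generic: coordinates satisfy no nonzero polynomial with rational coefficients. $\mathcal{S}^n_+$ is the cone of $n\times n$ positive semidefinite matrices, $e$ the all-ones vector, $K:\mathcal{S}^n\to\mathcal{S}^n$ the map $K(X)_{ij}=X_{ii}+X_{jj}-2X_{ij}$, and $\Pi_E$ the projection onto the entries indexed by $E$. The singularity degree of the system $\{X\in\mathcal{S}^n_+ : \Pi_E(K(X))=d_E,\ Xe=0\}$ is the minimum number of facial reduction steps ${\mathcal F}_0=\mathcal{S}^n_+$, ${\mathcal F}_{i+1}={\mathcal F}_i\cap Z_i^\perp$, with $Z_i={\mathcal M}^*v_i\in{\mathcal F}_i^*\setminus{\mathcal F}_i^\perp$ and $v_i$ orthogonal to the right-hand side, where ${\mathcal M}$ is the linear constraint map, needed to reach the smallest face of $\mathcal{S}^n_+$ containing the feasible set (degree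 $0$ meaning the feasible set meets the relative interior of the face $\{X\succeq 0: Xe=0\}$). Equivalently it is the singularity degree of the face of $\Pi_E(K(\{X\in\mathcal S^n_+: Xe=0\}))$ generated by $d_E$. An equilibrium stress of $(G,p)$ is $\omega:E\to\mathbb{R}$ with $\sum_{j:ij\in E}\omega_{ij}(p_i-p_j)=0$ for all $i$; its stress matrix $\Omega$ has off-diagonal entries $-\omega_{ij}$ ($0$ off $E$) and diagonal entries $\sum_j\omega_{ij}$. *)

(* Defs.v *)
From HB Require Import structures.
From mathcomp Require Import all_boot all_order all_algebra.
From mathcomp Require Import mpoly.
From mathcomp Require Import reals.

Set Implicit Arguments.
Unset Strict Implicit.
Unset Printing Implicit Defensive.

Import Order.TTheory GRing.Theory Num.Theory.
Local Open Scope ring_scope.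

Definition simple_graph (n : nat) (adj : rel 'I_n) : Prop :=
  (forall i j, adj i j = adj j i) /\ (forall i, ~~ adj i i).

Definition edges_in (n : nat) (adj : rel 'I_n) (S : {set 'I_n}) : nat :=
  #|[set ij : 'I_n * 'I_n |
      [&& (ij.1 < ij.2)%N, adj ij.1 ij.2, ij.1 \in S & ij.2 \in S]]|.

(* Laman-sparse: every subgraph with k >= 2 vertices has at most 2k-3 edges
   (it suffices to consider induced subgraphs, which have the most edges). *)
Definition laman_sparse (n : nat) (adj : rel 'I_n) : Prop :=
  forall S : {set 'I_n}, (2 <= #|S|)%N -> (edges_in adj S <= 2 * #|S| - 3)%N.

Definition generic (R : realType) (n : nat) (p : 'M[R]_(n, 2)) : Prop :=
  forall q : {mpoly rat[n * 2]}, q != 0 ->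
    (map_mpoly (ratr : rat -> R) q).@[fun k => mxvec p 0 k] != 0.

Definition sqdist (R : realType) (n : nat) (p : 'M[R]_(n, 2)) (i j : 'I_n) : R :=
  \sum_(k < 2) (p i k - p j k) ^+ 2.

Definition psd (R : realType) (n : nat) (X : 'M[R]_n) : Prop :=
  X^T = X /\ forall v : 'rV[R]_n, 0 <= (v *m X *m v^T) 0 0.

Definition Kmap (R : realType) (n : nat) (X : 'M[R]_n) : 'M[R]_n :=
  \matrix_(i, j) (X i i + X j j - 2 * X i j).

Definition edm_feasible (R : realType) (n : nat) (adj : rel 'I_n)
    (p : 'M[R]_(n, 2)) (X : 'M[R]_n) : Prop :=
  [/\ psd X, X *m const_mx 1 = 0 :> 'cV[R]_n &
      forall i j, adj i j -> Kmap X i j = sqdist p i j].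

Definition equilibrium_stress (R : realType) (n : nat) (adj : rel 'I_n)
    (p : 'M[R]_(n, 2)) (w : 'I_n -> 'I_n -> R) : Prop :=
  [/\ forall i j, w i j = w j i,
      forall i j, ~~ adj i j -> w i j = 0 &
      forall i, \sum_(j < n | adj i j) w i j *: (row i p - row j p) = 0].

Definition stress_matrix (R : realType) (n : nat) (w : 'I_n -> 'I_n -> R)
    : 'M[R]_n :=
  \matrix_(i, j) (if i == j then \sum_(k < n | k != i) w i k else - w i j).

(* Main.v *)
Require Import Defs.
From HB Require Import structures.
From mathcomp Require Import all_boot all_order all_algebra.
From mathcomp Require Import mpoly.
From mathcomp Require Import reals.
From mathcomp Require Import ring lra zify.
Import Order.TTheory GRing.Theory Num.Theory.

Set Implicit Arguments.
Unset Strict Implicit.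
Unset Printing Implicit Defensive.

(** At a generic configuration the edges of a Laman-sparse graph have linearly
    independent rigidity rows (the Geiringer-Laman theorem), proved by induction
    on the number of edges.  A sparse graph has a vertex v of degree at most 3.
    Degree 1 or 2: equilibrium at v kills the stress on the edges at v.
    Degree 3: for some pair a, b of neighbours of v, the graph G - v + ab is
    sparse; with v moved to the midpoint of ab, a stress of G is a stress of
    G - v + ab.  Independence passes from the special to the generic position
    because it is the nonvanishing of the determinant of the Gram matrix of the
    rigidity rows, a polynomial with rational coefficients.

    Hence (G, p) has no nonzero equilibrium stress.  Dually there is a velocity
    q with (p_i - p_j).(q_i - q_j) = -1 on every edge, and then, with J the
    centering projection and eps > 0 small,
    X = J (p p^T + eps (p q^T + q p^T) + eps I) J is feasible of rank n - 1,
    since p p^T + eps (p q^T + q p^T) + eps I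
      = (p + eps q) (p + eps q)^T + (eps I - eps^2 q q^T). *)

(** * Counting in sparse edge sets: tight sets, uncrossing, low degree *)

Section SparseEdgeSets.
Variable V : finType.
Implicit Types (E F : {set V * V}) (S T U : {set V}) (v a b c : V) (e : V * V).

Definition induced E S := [set e in E | (e.1 \in S) && (e.2 \in S)].

Definition loopless E := forall e, e \in E -> e.1 != e.2.

(** Adding 3 on the left avoids truncated subtraction. Edges are ordered pairs, so opposite pairs
    count twice and the bound rules them out; loops are left to [loopless]. *)
Definition sparse E := forall S, 1 < #|S| -> #|induced E S| + 3 <= 2 * #|S|.

Definition tight E S := [&& 1 < #|S| & 2 * #|S| <= #|induced E S| + 3].

Definition star E v := [set e in E | (e.1 == v) || (e.2 == v)].

Lemma induced_sub E F S : E \subset F -> #|induced E S| <= #|induced F S|.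
Proof.
move=> /subsetP sEF; apply: subset_leq_card; apply/subsetP=> e.
by rewrite !inE => /andP[/sEF -> ->].
Qed.

Lemma sparse_sub E F : E \subset F -> sparse F -> sparse E.
Proof. by move=> sEF sF S S2; have := sF S S2; have := induced_sub S sEF; lia. Qed.

Lemma induced_supermodular E S T :
  #|induced E S| + #|induced E T| <= #|induced E (S :|: T)| + #|induced E (S :&: T)|.
Proof.
rewrite -cardsUI; apply: leq_add; apply: subset_leq_card; apply/subsetP=> e.
  by rewrite !inE; case: (e \in E); case: (e.1 \in S); case: (e.2 \in S);
     case: (e.1 \in T); case: (e.2 \in T).
by rewrite !inE; case: (e \in E); case: (e.1 \in S); case: (e.2 \in S);
     case: (e.1 \in T); case: (e.2 \in T).
Qed.

(** By supermodularity: the sparsity bound on the intersection, available only from two vertices on,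
    forces enough edges into the union. *)
Lemma tightU E S T : sparse E -> tight E S -> tight E T -> 1 < #|S :&: T| ->
  tight E (S :|: T).
Proof.
move=> sE /andP[S2 tS] /andP[T2 tT] I2.
have := induced_supermodular E S T; have := sE _ I2; have := cardsUI S T.
have : #|S| <= #|S :|: T| by apply: subset_leq_card; apply: subsetUl.
by rewrite /tight; lia.
Qed.

Lemma induced_disjoint E S T : loopless E -> #|S :&: T| <= 1 ->
  [disjoint induced E S & induced E T].
Proof.
move=> lE /card_le1_eqP I1; apply/pred0P=> e /=; apply/negP.
rewrite !inE => /andP[/and3P[eE e1S e2S] /and3P[_ e1T e2T]].
have /eqP : e.1 = e.2 by apply: I1; rewrite !inE ?e1S ?e2S.
by apply/negP; apply: lE.
Qed.

(** Small overlaps make the induced edge sets disjoint, so their counts add up with total deficit 9.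
    Sharing [a], [b], [c] makes the union smaller than the sum of the sizes by at least 3, which
    regains 6 and leaves the deficit 3 of a tight set. *)
Lemma tight_triangle E S T U a b c : loopless E ->
  a != c -> a \in S -> b \in S -> b \in T -> c \in T -> c \in U -> a \in U ->
  tight E S -> tight E T -> tight E U ->
  #|S :&: T| <= 1 -> #|T :&: U| <= 1 -> #|S :&: U| <= 1 ->
  tight E ((S :|: T) :|: U).
Proof.
move=> lE ac aS bS bT cT cU aU /andP[S2 tS] /andP[T2 tT] /andP[U2 tU] ST TU SU.
have dST := induced_disjoint lE ST.
have dTU := induced_disjoint lE TU.
have dSU := induced_disjoint lE SU.
have I1 : 0 < #|S :&: T| by apply/card_gt0P; exists b; rewrite inE bS.
have I2 : 1 < #|(S :|: T) :&: U|.
  apply/card_gt1P; exists a, c; rewrite !inE aS aU cU cT orbT; split=> //.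
have cST := cardsUI S T; have cSTU := cardsUI (S :|: T) U.
have : #|S| <= #|S :|: T| by apply: subset_leq_card; apply: subsetUl.
have : #|S :|: T| <= #|(S :|: T) :|: U| by apply: subset_leq_card; apply: subsetUl.
have : #|(induced E S :|: induced E T) :|: induced E U| <=
       #|induced E ((S :|: T) :|: U)|.
  apply: subset_leq_card; apply/subsetP=> e; rewrite !inE.
  by case: (e \in E); case: (e.1 \in S); case: (e.2 \in S); case: (e.1 \in T);
     case: (e.2 \in T); case: (e.1 \in U); case: (e.2 \in U).
have := cardsUI (induced E S :|: induced E T) (induced E U).
rewrite setIUl !disjoint_setI0 // setU0 cards0 addn0 => ->.
have := cardsUI (induced E S) (induced E T).
rewrite disjoint_setI0 // cards0 addn0 => ->.
by rewrite /tight; lia.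
Qed.

Definition addable E a b := (a, b) \notin E /\ sparse ((a, b) |: E).

(** Only sets containing both ends gain an edge, and these have room for one. The edge is new
    because its presence would already make the pair [[set a; b]] tight. *)
Lemma addable_not_tight E a b : a != b -> sparse E ->
  (forall S, a \in S -> b \in S -> ~~ tight E S) -> addable E a b.
Proof.
move=> ab sE nt; split.
  apply/negP=> abE; have /negP[] := nt [set a; b] (set21 a b) (set22 a b).
  have : 0 < #|induced E [set a; b]|.
    by apply/card_gt0P; exists (a, b); rewrite inE abE set21 set22.
  by rewrite /tight cards2 ab; lia.
move=> S S2; have := sE S S2; have := nt S.
case aS: (a \in S); case bS: (b \in S).
- move=> /(_ isT isT); rewrite /tight S2 andTb => ? ?.
  suff : #|induced ((a, b) |: E) S| <= 1 + #|induced E S| by lia.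
  rewrite -(cards1 (a, b)); apply: leq_trans (leq_card_setU _ _).
  apply: subset_leq_card; apply/subsetP=> e; rewrite !inE.
  by case: (e == (a, b)) => //=; case: (e \in E).
all: move=> _ le; suff -> : induced ((a, b) |: E) S = induced E S by [].
all: apply/setP=> e; rewrite !inE; case: eqP => [->|] //=.
all: by rewrite aS bS ?andbF.
Qed.

(* A set containing all three neighbours of v must leave room for the edges at
   v, so it is not tight without them.  If every pair of neighbours lay in a
   tight set, uncrossing these sets would produce such a tight set. *)
Lemma sparse_split E v a b c : loopless E -> sparse E -> #|star E v| = 3 ->
  {in star E v, forall e, e.1 \in [:: v; a; b; c] /\ e.2 \in [:: v; a; b; c]} ->
  a != b -> b != c -> a != c ->
  [\/ addable (E :\: star E v) a b,
      addable (E :\: star E v) b c |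
      addable (E :\: star E v) a c].
Proof.
move=> lE sE d3 nbr ab bc ac; set E' := E :\: _.
have sE' : sparse E' by apply: sparse_sub sE; apply: subsetDl.
have lE' : loopless E' by move=> e; rewrite inE => /andP[_]; apply: lE.
have nabc S : a \in S -> b \in S -> c \in S -> ~~ tight E' S.
  (* Adjoining [v] to such a tight set would bring three edges for at most one new vertex, against
     the sparsity of [E]. *)
  move=> aS bS cS; apply/negP=> /andP[S2 tS].
  have sub : induced E' S :|: star E v \subset induced E (v |: S).
    apply/subsetP=> e; rewrite inE => /orP[].
      by rewrite !inE => /and3P[/andP[_ ->] -> ->]; rewrite !orbT.
    move=> eE; have [] := nbr e eE; move: eE.
    rewrite !inE => /andP[-> _] /=.
    by move=> /or4P[] /eqP-> /or4P[] /eqP->; rewrite ?eqxx ?aS ?bS ?cS ?orbT.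
  have dis : induced E' S :&: star E v = set0.
    by apply/setP=> e; rewrite !inE; case: (e \in E); case: (_ || _); rewrite /= ?andbF.
  have := cardsUI (induced E' S) (star E v); rewrite dis cards0 d3.
  have := subset_leq_card sub.
  have vS2 : 1 < #|v |: S| by rewrite cardsU1; lia.
  have := sE _ vS2; rewrite cardsU1; lia.
have blocked x y : x != y -> addable E' x y \/ exists S, [/\ x \in S, y \in S & tight E' S].
  move=> xy.
  case: (pickP [pred S : {set V} | [&& x \in S, y \in S & tight E' S]]) => [S /and3P[]|nS].
    by right; exists S.
  left; apply: addable_not_tight => // S xS yS; have := nS S; rewrite /= xS yS /=.
  by move=> ->.
case: (blocked a b ab) => [|[S [aS bS tS]]]; first by constructor 1.
case: (blocked b c bc) => [|[T [bT cT tT]]]; first by constructor 2.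
case: (blocked a c ac) => [|[U [aU cU tU]]]; first by constructor 3.
have join A B : tight E' A -> tight E' B -> a \in A :|: B -> b \in A :|: B ->
    c \in A :|: B -> #|A :&: B| <= 1.
  move=> tA tB aAB bAB cAB; rewrite leqNgt; apply/negP=> I2.
  by have := nabc _ aAB bAB cAB; rewrite tightU.
have ST : #|S :&: T| <= 1 by apply: join; rewrite // inE ?aS ?bS ?cT ?orbT.
have TU : #|T :&: U| <= 1 by apply: join; rewrite // inE ?bT ?cT ?aU ?orbT.
have SU : #|S :&: U| <= 1 by apply: join; rewrite // inE ?aS ?bS ?cU ?orbT.
have := nabc ((S :|: T) :|: U); rewrite !inE aS bS cU !orbT => /(_ isT isT isT).
by move=> /negP[]; apply: (tight_triangle (a := a) (b := b) (c := c)).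
Qed.

(** Over the set [U] of non-isolated vertices the degrees sum to at most [4 * #|U| - 6], so they
    cannot all be 4 or more. *)
Lemma sparse_low_degree E : loopless E -> sparse E -> E != set0 ->
  exists v, 0 < #|star E v| < 4.
Proof.
move=> lE sE /set0Pn[e0 e0E].
pose U := [set v | star E v != set0].
have memU e v : e \in E -> (v == e.1) || (v == e.2) -> v \in U.
  by move=> eE ve; rewrite inE; apply/set0Pn; exists e; rewrite inE eE !(eq_sym _ v).
have U2 : 1 < #|U|.
  apply/card_gt1P; exists e0.1, e0.2; split; last exact: lE.
    by apply: (memU e0); rewrite ?eqxx.
  by apply: (memU e0); rewrite ?eqxx ?orbT.
have EU : induced E U = E.
  apply/setP=> e; rewrite inE; case eE: (e \in E) => //=.
  by rewrite !(memU e) ?eqxx ?orbT.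
have := sE U U2; rewrite EU => cE.
case: (pickP [pred v | 0 < #|star E v| < 4]) => [v|nov]; first by exists v.
have : \sum_(v in U) 4 <= \sum_(v in U) #|star E v|.
  apply: leq_sum => v; rewrite inE -card_gt0 => dv.
  by have /= := nov v; rewrite dv /= ltnNge => /negbFE.
have : \sum_(v in U) #|star E v| <= \sum_(e in E) 2.
  rewrite (eq_bigr (fun v => \sum_(e in E) ((e.1 == v) || (e.2 == v) : nat))); last first.
    move=> v _; rewrite -sum1_card big_mkcond [RHS]big_mkcond /=.
    by apply: eq_bigr => e _; rewrite inE; case: (e \in E).
  rewrite exchange_big /=; apply: leq_sum => e _.
  apply: (@leq_trans (\sum_(v : V) ((e.1 == v : nat) + (e.2 == v : nat)))).
    rewrite big_mkcond /=; apply: leq_sum => v _.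
    by case: (v \in U); case: (e.1 == v); case: (e.2 == v).
  rewrite big_split /=.
  have one x : \sum_(v : V) (x == v : nat) = 1.
    by rewrite (bigD1 x) //= eqxx big1 // => v; rewrite eq_sym => /negbTE->.
  by rewrite !one.
rewrite !sum_nat_const; lia.
Qed.

Lemma sparse_antiparallel E a b : sparse E -> (a, b) \in E -> (b, a) \in E -> a = b.
Proof.
move=> sE abE baE; apply/eqP/negPn/negP=> ab.
have S2 : 1 < #|[set a; b]| by rewrite cards2 ab.
have := sE _ S2; rewrite cards2 ab.
suff : 1 < #|induced E [set a; b]| by lia.
apply/card_gt1P; exists (a, b), (b, a).
by rewrite !inE abE baE /= !eqxx !orbT xpair_eqE negb_and ab.
Qed.

End SparseEdgeSets.

Local Open Scope ring_scope.

(** * Rigidity matrices and Gram determinants *)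

Section RigidityMatrix.
Variables (n : nat) (A : comNzRingType).
Implicit Types (E : {set 'I_n * 'I_n}) (p q : 'M[A]_(n, 2)).

Definition edge_form p q (e : 'I_n * 'I_n) : A :=
  \sum_(k < 2) (p e.1 k - p e.2 k) * (q e.1 k - q e.2 k).

Definition rigidity_mx E p : 'M[A]_(#|E|, n * 2) :=
  \matrix_k mxvec (\matrix_(i < n, l < 2)
    let e := enum_val k in
    ((i == e.1)%:R - (i == e.2)%:R) * (p e.1 l - p e.2 l)).

Lemma rigidity_mxE E p q k :
  (rigidity_mx E p *m (mxvec q)^T) k 0 = edge_form p q (enum_val k).
Proof.
pose F i l := rigidity_mx E p k (mxvec_index i l) * (mxvec q)^T (mxvec_index i l) 0.
rewrite mxE (reindex _ (curry_mxvec_bij _ _)) (eq_bigr (fun il => F il.1 il.2)).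
2: by case.
rewrite -(pair_bigA _ F) /F.
rewrite exchange_big /=; apply: eq_bigr => l _.
set e := enum_val k.
have pick (j : 'I_n) : \sum_i (i == j)%:R * q i l = q j l.
  rewrite (bigD1 j) //= eqxx mul1r big1 ?addr0 // => i /negbTE->.
  by rewrite mul0r.
rewrite -!pick -sumrB mulr_sumr; apply: eq_bigr => i _.
rewrite mxE [in X in _ * X]mxE !mxvecE mxE -/e /=; ring.
Qed.

End RigidityMatrix.

Lemma map_rigidity_mx n (A B : comNzRingType) (f : {rmorphism A -> B})
    (E : {set 'I_n * 'I_n}) (p : 'M[A]_(n, 2)) :
  map_mx f (rigidity_mx E p) = rigidity_mx E (map_mx f p).
Proof.
apply/matrixP=> k j; case/mxvec_indexP: j => i l.
by rewrite !mxE !mxvecE !mxE /= rmorphM !rmorphB !rmorph_nat !mxE.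
Qed.

Lemma dotmx_eq0 (R : realDomainType) m (u : 'rV[R]_m) :
  (u *m u^T) 0 0 = 0 -> u = 0.
Proof.
rewrite mxE => /eqP; rewrite psumr_eq0 => [/allP u0|i _]; last first.
  by rewrite mxE -expr2 sqr_ge0.
apply/rowP=> i; apply/eqP; rewrite mxE -sqrf_eq0 expr2.
by have := u0 i (mem_index_enum _); rewrite mxE.
Qed.

(** Over an ordered field, [u *m M *m M^T = 0] forces [u *m M] to have norm zero. Independence of
    rows thus becomes the nonvanishing of one polynomial, with no choice of a minor. *)
Lemma row_free_gram (R : realFieldType) m k (M : 'M[R]_(m, k)) :
  row_free M = (\det (M *m M^T) != 0).
Proof.
apply/idP/idP=> [Mf|].
  apply/negP=> /det0P[u u0 uMM]; move/eqP: u0; apply.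
  apply: (row_free_inj Mf); rewrite mul0mx; apply: dotmx_eq0.
  by rewrite trmx_mul mulmxA -(mulmxA u) uMM mul0mx mxE.
move=> d0; apply: inj_row_free => u uM; apply/eqP/negPn/negP=> u0.
by move/negP: d0; apply; apply/det0P; exists u; rewrite // mulmxA uM mul0mx.
Qed.

(** * Independence of edges as a generic property *)

Section Independence.
Variables (R : realType) (n : nat).
Implicit Types (E : {set 'I_n * 'I_n}) (p q : 'M[R]_(n, 2)).

(* Equilibrium at every vertex, tested against all velocity fields q. *)
Definition self_stress E p (w : 'I_n * 'I_n -> R) :=
  forall q, \sum_(e in E) w e * edge_form p q e = 0.

Definition independent E p :=
  forall w, self_stress E p w -> {in E, forall e, w e = 0}.

Lemma independentP E p : independent E p <-> row_free (rigidity_mx E p).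
Proof.
split=> [ind|Mf w ss e eE].
  apply: inj_row_free => u uM.
  pose w e := \sum_(k < #|E|) (if enum_val k == e then u 0 k else 0).
  have wE k : w (enum_val k) = u 0 k.
    rewrite /w (bigD1 k) //= eqxx big1 ?addr0 // => i /negbTE ik.
    by rewrite (inj_eq enum_val_inj) ik.
  apply/rowP=> k; rewrite mxE -wE; apply: ind (enum_valP k) => q.
  rewrite big_enum_val; under eq_bigr do rewrite wE -rigidity_mxE.
  by have := congr1 (fun x => (x *m (mxvec q)^T) 0 0) uM;
     rewrite -mulmxA mul0mx mxE [RHS]mxE.
pose u : 'rV_#|E| := \row_k w (enum_val k).
suff u0 : u = 0.
  have /(congr1 (fun x : 'rV_ _ => x 0 (enum_rank_in eE e))) := u0.
  by rewrite !mxE enum_rankK_in.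
apply: (row_free_inj Mf); rewrite mul0mx; apply: dotmx_eq0.
(* The stress is tested against the velocity [u *m rigidity_mx E p] that it generates itself, which
   gives a squared norm. *)
rewrite -{2}(vec_mxK (u *m _)) -mulmxA mxE -[RHS](ss (vec_mx (u *m rigidity_mx E p))).
by rewrite [RHS]big_enum_val; apply: eq_bigr => k _; rewrite rigidity_mxE mxE.
Qed.

Definition eval_at p : {mpoly rat[n * 2]} -> R :=
  meval (fun k => mxvec p 0 k) \o map_mpoly ratr.

HB.instance Definition _ p := GRing.RMorphism.on (eval_at p).

Definition universal_config : 'M[{mpoly rat[n * 2]}]_(n, 2) :=
  \matrix_(i, k) 'X_(mxvec_index i k).

Lemma eval_universalE p i k : eval_at p (universal_config i k) = p i k.
Proof. by rewrite mxE /eval_at /= map_mpolyX mevalXU mxvecE. Qed.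

Lemma eval_universal p : map_mx (eval_at p) universal_config = p.
Proof.
by apply/matrixP=> i k; rewrite mxE eval_universalE.
Qed.

(** A nonzero value at any single [p0] certifies that [f] is not the zero polynomial. *)
Lemma generic_neq0 p0 p (f : {mpoly rat[n * 2]}) :
  generic p -> eval_at p0 f != 0 -> eval_at p f != 0.
Proof.
move=> gp f0; apply: gp; apply: contraNneq f0 => ->.
by rewrite rmorph0.
Qed.

Lemma generic_independent E p0 p : generic p -> independent E p0 -> independent E p.
Proof.
move=> gp /independentP; rewrite row_free_gram => d0; apply/independentP.
pose X := rigidity_mx E universal_config; pose f := \det (X *m X^T).
have fE p1 : eval_at p1 f = \det (rigidity_mx E p1 *m (rigidity_mx E p1)^T).
  by rewrite -det_map_mx map_mxM -map_trmx map_rigidity_mx eval_universal.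
by rewrite row_free_gram -fE (generic_neq0 (p0 := p0)) // fE.
Qed.

End Independence.

(** * Removal of a vertex of degree 1, 2 or 3 *)

Section Henneberg.
Variables (R : realType) (n : nat).
Implicit Types (E : {set 'I_n * 'I_n}) (p q : 'M[R]_(n, 2)) (v a b c : 'I_n)
  (e f g : 'I_n * 'I_n).

(** Twice the signed area of the triangle [a], [b], [c]. *)
Definition cross p a b c :=
  (p b 0 - p a 0) * (p c 1 - p a 1) - (p c 0 - p a 0) * (p b 1 - p a 1).

Lemma generic_distinct p a b : generic p -> a != b -> p a 0 != p b 0.
Proof.
move=> gp ab; pose X := @universal_config n.
pose p0 : 'M[R]_(n, 2) := \matrix_(i, k) (i == a)%:R.
have evE p1 : eval_at p1 (X a 0 - X b 0) = p1 a 0 - p1 b 0.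
  by rewrite rmorphB /= !eval_universalE.
rewrite -subr_eq0 -evE (generic_neq0 (p0 := p0)) // evE.
by rewrite /p0 !mxE eqxx (eq_sym b) (negbTE ab) subr0 oner_eq0.
Qed.

Lemma generic_cross p a b c : generic p -> a != b -> b != c -> a != c ->
  cross p a b c != 0.
Proof.
move=> gp ab bc ac; pose X := @universal_config n.
(* Witness: [b] at (1, 0), [c] at (0, 1), every other point at the origin. *)
pose p0 : 'M[R]_(n, 2) := \matrix_(i, k) (i == if k == 0 then b else c)%:R.
have evE p1 : eval_at p1 ((X b 0 - X a 0) * (X c 1 - X a 1)
    - (X c 0 - X a 0) * (X b 1 - X a 1)) = cross p1 a b c.
  by rewrite rmorphB !rmorphM !rmorphB /= !eval_universalE.
rewrite -evE (generic_neq0 (p0 := p0)) // evE /cross.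
rewrite /p0 !mxE !eqxx /= (negbTE ab) (negbTE bc) (negbTE ac) (eq_sym c).
by rewrite (negbTE bc) !subr0 mul0r mulr1 subr0 oner_eq0.
Qed.

Lemma edge_formE p q a b : edge_form p q (a, b) =
  (p a 0 - p b 0) * (q a 0 - q b 0) + (p a 1 - p b 1) * (q a 1 - q b 1).
Proof.
rewrite /edge_form !big_ord_recl big_ord0 addr0 /=.
by rewrite (_ : lift ord0 ord0 = 1) //; apply: val_inj.
Qed.

Lemma edge_form_swap p q a b : edge_form p q (a, b) = edge_form p q (b, a).
Proof. by rewrite !edge_formE; ring. Qed.

Definition other v e := if e.1 == v then e.2 else e.1.

Lemma star_other E v e : e \in star E v ->
  e = (v, other v e) \/ e = (other v e, v).
Proof.
rewrite inE /other; case: e => a b /= /andP[_].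
by case: eqP => [-> _|_ /= /eqP->]; [left|right].
Qed.

Lemma other_neq E v e : loopless E -> e \in star E v -> other v e != v.
Proof.
move=> lE eS; have /lE : e \in E by move: eS; rewrite inE => /andP[].
by case: (star_other eS) => {1 2}->; rewrite //= eq_sym.
Qed.

Lemma other_inj E v : sparse E -> loopless E -> {in star E v &, injective (other v)}.
Proof.
move=> sE lE e f eS fS ef.
have eE : e \in E by move: eS; rewrite inE => /andP[].
have fE : f \in E by move: fS; rewrite inE => /andP[].
have /eqP ne := other_neq lE eS.
case: (star_other eS) => eq1; case: (star_other fS) => eq2.
- by rewrite eq1 eq2 ef.
- case: ne; apply: (sparse_antiparallel sE); last by rewrite -eq1.
  by rewrite ef -eq2.
- case: ne; apply: (sparse_antiparallel sE); first by rewrite -eq1.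
  by rewrite ef -eq2.
- by rewrite eq1 eq2 ef.
Qed.

Lemma edge_form_star E v e p q : e \in star E v ->
  edge_form p q e = edge_form p q (v, other v e).
Proof. by move=> eS; case: (star_other eS) => {1}->; rewrite // edge_form_swap. Qed.

Lemma star_split E v (F : 'I_n * 'I_n -> R) : \sum_(e in E) F e =
  \sum_(e in star E v) F e + \sum_(e in E :\: star E v) F e.
Proof.
rewrite (big_setID (star E v)) /=; congr (_ + _); apply: eq_bigl => e.
by rewrite !inE; case: (e \in E).
Qed.

Lemma star_compl E v e : e \in E :\: star E v -> (e.1 != v) && (e.2 != v).
Proof. by rewrite !inE => /andP[+ eE]; rewrite eE negb_or. Qed.

Lemma self_stress_vertex E p w v k : loopless E -> self_stress E p w ->
  \sum_(e in star E v) w e * (p v k - p (other v e) k) = 0.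
Proof.
move=> lE ss.
(* Test velocity: the unit vector in direction [k] at [v], zero elsewhere, so only edges at [v]
   contribute. *)
have := ss (\matrix_(i, j) ((i == v) && (j == k))%:R); rewrite (star_split _ v).
rewrite [X in _ + X]big1 ?addr0 => [s0|e /star_compl/andP[e1 e2]]; last first.
  rewrite /edge_form big1 ?mulr0 // => j _.
  by rewrite !mxE (negbTE e1) (negbTE e2) subrr mulr0.
rewrite -[RHS]s0; apply: eq_bigr => e eS; rewrite (edge_form_star _ _ eS); congr (_ * _).
rewrite /edge_form (bigD1 k) //= big1 ?addr0 => [|j /negbTE jk].
  by rewrite !mxE !eqxx (negbTE (other_neq lE eS)) subr0 mulr1.
by rewrite !mxE jk !andbF subrr mulr0.
Qed.

Lemma independent_star0 E p w v : independent (E :\: star E v) p ->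
  self_stress E p w -> {in star E v, forall e, w e = 0} ->
  {in E, forall e, w e = 0}.
Proof.
move=> ind ss w0 e eE; case eS: (e \in star E v); first exact: w0.
apply: ind; last by rewrite inE eS.
move=> q; rewrite -[RHS](ss q) (star_split E v) [X in _ = X + _]big1 ?add0r //.
by move=> f /w0->; rewrite mul0r.
Qed.

Lemma independent_low_degree E p v : loopless E -> sparse E -> generic p ->
  (0 < #|star E v| < 3)%N -> independent (E :\: star E v) p -> independent E p.
Proof.
move=> lE sE gp deg ind w ss; apply: (independent_star0 ind) => //.
have eqv k := self_stress_vertex v k lE ss.
have : (#|star E v| == 1%N) || (#|star E v| == 2) by move: deg; lia.
case/orP=> [/cards1P[e dE]|/cards2P[e [f [ef dE]]]].
  have eS : e \in star E v by rewrite dE set11.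
  have := eqv 0; rewrite dE big_set1 => /eqP; rewrite mulf_eq0 subr_eq0.
  rewrite (negbTE (generic_distinct gp _)) ?orbF 1?eq_sym ?(other_neq lE) // => /eqP we0.
  by move=> x; rewrite inE => /eqP->.
have eS : e \in star E v by rewrite dE set21.
have fS : f \in star E v by rewrite dE set22.
have e0 := eqv 0; have e1 := eqv 1.
rewrite dE big_setU1 ?inE //= big_set1 in e0; rewrite dE big_setU1 ?inE //= big_set1 in e1.
have D : cross p v (other v e) (other v f) != 0.
  apply: generic_cross => //; rewrite 1?eq_sym ?(other_neq lE) //.
  by rewrite (inj_in_eq (other_inj sE lE)) // eq_sym.
have we : w e = 0.
  apply/eqP; rewrite -(mulIr_eq0 _ (mulIf D)) /cross; apply/eqP.
  move: e0 e1; move: (w e) (w f) => x y; move: (other v e) (other v f) => a b e0 e1.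
  (* Cramer's rule: this combination of the two equilibrium coordinates eliminates [y]. *)
  transitivity ((x * (p v 0 - p a 0) + y * (p v 0 - p b 0)) * (p v 1 - p b 1)
     - (x * (p v 1 - p a 1) + y * (p v 1 - p b 1)) * (p v 0 - p b 0)); first by ring.
  by rewrite e0 e1; ring.
have wf : w f = 0.
  apply/eqP; move: e0; rewrite we mul0r add0r => /eqP; rewrite mulf_eq0 subr_eq0.
  by rewrite (negbTE (generic_distinct gp _)) ?orbF 1?eq_sym ?(other_neq lE).
by move=> x; rewrite dE !inE => /orP[] /eqP->.
Qed.

(* Placing v at the midpoint of a and b, the three edges at v act like the
   single edge ab. *)
Lemma independent_midpoint E p v e f g : loopless E ->
  star E v = e |: (f |: [set g]) -> e != f -> f != g -> e != g ->
  cross p (other v e) (other v f) (other v g) != 0 ->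
  (other v e, other v f) \notin E :\: star E v ->
  independent ((other v e, other v f) |: (E :\: star E v)) p ->
  independent E (\matrix_(i, k)
    if i == v then (p (other v e) k + p (other v f) k) / 2 else p i k).
Proof.
move=> lE dE ef fg eg D abE ind; set p' := \matrix_(_, _) _; move=> w ss.
have eS : e \in star E v by rewrite dE !inE eqxx.
have fS : f \in star E v by rewrite dE !inE eqxx orbT.
have gS : g \in star E v by rewrite dE !inE eqxx !orbT.
have sumS (F : 'I_n * 'I_n -> R) : \sum_(x in star E v) F x = F e + (F f + F g).
  by rewrite dE !big_setU1 ?inE ?negb_or ?ef ?eg //= big_set1.
have p'v k : p' v k = (p (other v e) k + p (other v f) k) / 2 by rewrite mxE eqxx.
have p'o x k : x \in star E v -> p' (other v x) k = p (other v x) k.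
  by move=> xS; rewrite mxE (negbTE (other_neq lE xS)).
have eqv k := self_stress_vertex v k lE ss.
have e0 := eqv 0; have e1 := eqv 1.
rewrite sumS p'v !p'o // in e0; rewrite sumS p'v !p'o // in e1.
have ss' q : w e * edge_form p' q (v, other v e) + (w f * edge_form p' q (v, other v f)
   + w g * edge_form p' q (v, other v g)) + \sum_(x in E :\: star E v) w x * edge_form p q x = 0.
  rewrite -[RHS](ss q) (star_split E v) sumS -!(edge_form_star _ _ _ (E := E)) //.
  congr (_ + _); apply: eq_bigr => x /star_compl/andP[x1 x2]; congr (_ * _).
  by apply: eq_bigr => k _; rewrite !mxE (negbTE x1) (negbTE x2).
have eform q x : x \in star E v -> edge_form p' q (v, other v x) =
   ((p (other v e) 0 + p (other v f) 0) / 2 - p (other v x) 0) * (q v 0 - q (other v x) 0) +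
   ((p (other v e) 1 + p (other v f) 1) / 2 - p (other v x) 1) * (q v 1 - q (other v x) 1).
  by move=> xS; rewrite edge_formE !p'v !p'o.
(* As [v] lies on the line through the other ends of [e] and [f], the cross product of the
   equilibrium at [v] with the direction of that line leaves only the term of [g]. *)
have wg : w g = 0.
  apply/eqP; rewrite -(mulIr_eq0 _ (mulIf D)) /cross; apply/eqP.
  move: e0 e1; move: (w e) (w f) (w g) => x y z.
  move: (other v e) (other v f) (other v g) => a b c e0 e1.
  set l0 := (X in X = 0) in e0; set l1 := (X in X = 0) in e1.
  transitivity (l0 * (p b 1 - p a 1) - l1 * (p b 0 - p a 0)); last by rewrite e0 e1; ring.
  by rewrite /l0 /l1; field.
(* The rest of the equilibrium at [v] is [(w e - w f) / 2] times the vector between the other ends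
   of [e] and [f], which is nonzero by [D]. *)
have wef : w e = w f.
  apply/eqP; rewrite -subr_eq0; apply/negPn/negP=> nef.
  move: D; rewrite /cross.
  have h k : p (other v f) k - p (other v e) k = 0.
    apply/eqP; rewrite -(mulrI_eq0 _ (mulfI nef)); apply/eqP.
    have := eqv k; rewrite sumS p'v !p'o // wg => ek.
    transitivity (2 * 0 : R); last by rewrite mulr0.
    by rewrite -ek; field.
  by rewrite !h mul0r mulr0 subrr eqxx.
(* With equal weights the velocity of [v] cancels; the factor 1/2 arises because [e] and [f] each
   span half of the new edge. *)
pose w' x := if x == (other v e, other v f) then w e / 2 else w x.
have w'0 : {in (other v e, other v f) |: (E :\: star E v), forall x, w' x = 0}.
  apply: ind => q; rewrite big_setU1 //= {1}/w' eqxx -[RHS](ss' q); congr (_ + _).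
    by rewrite !eform // edge_formE wg -wef; field.
  apply: eq_bigr => x xE; rewrite /w'; case: eqP => // xab.
  by rewrite xab in xE; rewrite xE in abE.
have we : w e = 0.
  have := w'0 _ (setU11 _ _); rewrite /w' eqxx => /eqP.
  by rewrite mulf_eq0 invr_eq0 pnatr_eq0 orbF => /eqP.
move=> x xE; case xS: (x \in star E v).
  by move: xS; rewrite dE !inE => /or3P[] /eqP->; rewrite -?wef.
have xE' : x \in E :\: star E v by rewrite inE xS.
have := w'0 x (setU1r _ xE'); rewrite /w'; case: eqP => // xab.
by rewrite xab in xE'; rewrite xE' in abE.
Qed.

Lemma set3_rot (T : finType) (x y z : T) : x |: (y |: [set z]) = y |: (z |: [set x]).
Proof. by apply/setP=> t; rewrite !inE [RHS]orbA orbC. Qed.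

Lemma sparse_independent E p : loopless E -> sparse E -> generic p -> independent E p.
Proof.
(* Induction on an upper bound for [#|E|], since a degree 3 step lowers the count by two. *)
move=> + + gp; move: {2}#|E| (leqnn #|E|) => m.
elim: m E => [|m IH] E cE lE sE.
  by move=> w _ e; move: cE; rewrite leqn0 cards_eq0 => /eqP->; rewrite inE.
have [->|E0] := eqVneq E set0; first by move=> w _ e; rewrite inE.
have [v /andP[d0 d4]] := sparse_low_degree lE sE E0.
have sub : star E v \subset E by apply/subsetP=> e; rewrite inE => /andP[].
have cD := cardsD E (star E v); rewrite (setIidPr sub) in cD.
have lE' : loopless (E :\: star E v) by move=> e; rewrite inE => /andP[_]; apply: lE.
have sE' : sparse (E :\: star E v) by apply: sparse_sub sE; apply: subsetDl.
have [d2|d3] := ltnP #|star E v| 3.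
  apply: (independent_low_degree (v := v)) => //; first by rewrite d0.
  by apply: IH => //; rewrite cD leq_subLR (leq_trans cE) // -add1n leq_add2r.
have {d0 d3 d4} d3 : #|star E v| = 3 by lia.
have [e eS] : exists e, e \in star E v by apply/card_gt0P; rewrite d3.
have : #|star E v :\ e| == 2.
  by have := cardsD1 e (star E v); rewrite eS d3 add1n => -[<-].
case/cards2P=> f [g [fg dfg]].
have dE : star E v = e |: (f |: [set g]) by rewrite -(setD1K eS) dfg.
have : f \in star E v :\ e by rewrite dfg set21.
rewrite in_setD1 => /andP[fe fS].
have : g \in star E v :\ e by rewrite dfg set22.
rewrite in_setD1 => /andP[ge gS].
have neq x y : x \in star E v -> y \in star E v -> x != y -> other v x != other v y.
  by move=> xS yS xy; rewrite (inj_in_eq (other_inj sE lE)).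
have step x y z : x \in star E v -> y \in star E v -> z \in star E v ->
    star E v = x |: (y |: [set z]) -> x != y -> y != z -> x != z ->
    addable (E :\: star E v) (other v x) (other v y) -> independent E p.
  move=> xS yS zS dS xy yz xz [nE sU].
  (* The midpoint position is not assumed generic; the induction hypothesis is applied at [p], as
     the smaller graph has no edge at [v]. *)
  apply: (generic_independent gp); apply: (independent_midpoint (p := p) lE dS) => //.
    by apply: generic_cross => //; apply: neq.
  apply: IH => //.
    rewrite cardsU1 nE cD d3 add1n -subSn; last by rewrite -d3 subset_leq_card.
    by rewrite leq_subLR; apply: leq_trans (leqnSn m.+2).
  by move=> u; rewrite in_setU1 => /orP[/eqP->|/lE'] //=; apply: neq.
have nbr : {in star E v, forall x,
    x.1 \in [:: v; other v e; other v f; other v g] /\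
    x.2 \in [:: v; other v e; other v f; other v g]}.
  move=> x xS; case: (star_other xS) => {1 2}-> /=; move: xS;
  by rewrite dE !inE => /or3P[] /eqP->; rewrite !eqxx ?orbT.
rewrite eq_sym in fe; rewrite eq_sym in ge.
have [] := sparse_split lE sE d3 nbr (neq _ _ eS fS fe) (neq _ _ fS gS fg) (neq _ _ eS gS ge).
- exact: (step e f g).
- have dE2 : star E v = f |: (g |: [set e]) by rewrite dE set3_rot.
  by apply: (step f g e) => //; rewrite eq_sym.
- have dE3 : star E v = e |: (g |: [set f]) by rewrite dE; congr (_ |: _); rewrite setUC.
  by apply: (step e g f) => //; rewrite eq_sym.
Qed.

End Henneberg.

(** * From adjacency relations to edge sets, stresses and velocities *)

Section Graph.
Variables (R : realType) (n : nat) (adj : rel 'I_n).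
Hypothesis sadj : simple_graph adj.

Definition edge_set := [set e : 'I_n * 'I_n | (e.1 < e.2)%N && adj e.1 e.2].

Lemma edge_set_loopless : loopless edge_set.
Proof. by move=> e; rewrite inE => /andP[e12 _]; rewrite -val_eqE ltn_eqF. Qed.

Lemma edge_set_sparse : laman_sparse adj -> sparse edge_set.
Proof.
move=> lam S S2; have := lam S S2; rewrite /edges_in.
rewrite (_ : [set _ | _] = induced edge_set S); last first.
  by apply/setP=> e; rewrite !inE -andbA.
by move: #|induced _ _| #|S| S2 => k l; lia.
Qed.

Lemma adj_edge_set i j : adj i j -> (i, j) \in edge_set \/ (j, i) \in edge_set.
Proof.
case: sadj => sym irr; rewrite !inE /= => aij; rewrite (sym j i) aij !andbT.
by case: (ltngtP i j) => [||/val_inj ij]; [left|right|move: aij; rewrite ij (negbTE (irr j))].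
Qed.

(** Pairing the equilibrium at each vertex with its velocity and summing meets every edge from both
    ends; the two contributions combine into its [edge_form]. *)
Lemma equilibrium_self_stress (p : 'M[R]_(n, 2)) w :
  equilibrium_stress adj p w -> self_stress edge_set p (fun e => w e.1 e.2).
Proof.
case=> wsym w0 weq q.
pose H (e : 'I_n * 'I_n) := w e.1 e.2 * \sum_k (p e.1 k - p e.2 k) * q e.1 k.
pose swap (e : 'I_n * 'I_n) := (e.2, e.1).
have swapK : involutive swap by case.
have -> : \sum_(e in edge_set) w e.1 e.2 * edge_form p q e = \sum_e H e.
  rewrite (eq_bigr (fun e => H e + H (swap e))); last first.
    move=> [i j] _; rewrite /H /= (wsym j i) -mulrDr -big_split /=; congr (_ * _).
    by apply: eq_bigr => k _; ring.
  rewrite big_split /= [RHS](bigID (mem edge_set)) /=; congr (_ + _).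
  rewrite (reindex_inj (inv_inj swapK)) big_mkcond [RHS]big_mkcond /=.
  apply: eq_bigr => -[i j] _; rewrite !inE /=.
  case: sadj => sym irr; rewrite (sym j i).
  case: (ltngtP i j) => [|//|/val_inj ->]; rewrite /= ?(negbTE (irr j)) //=.
  - by rewrite /H /=; case aij: (adj i j) => //=; rewrite (w0 i j) ?aij // mul0r.
  - by rewrite /H /=; case aij: (adj i j) => //=; rewrite (w0 i j) ?aij // mul0r.
  - by rewrite /H /= (w0 j j) ?irr // mul0r.
rewrite -(pair_bigA _ (fun i j => H (i, j))) /= big1 // => i _.
rewrite /H /=; under eq_bigr do rewrite mulr_sumr.
rewrite exchange_big big1 //= => k _.
transitivity ((\sum_(j < n | adj i j) w i j *: (row i p - row j p)) 0 k * q i k).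
  rewrite summxE mulr_suml [RHS]big_mkcond /=; apply: eq_bigr => j _.
  case aij: (adj i j); first by rewrite !mxE mulrA.
  by rewrite (w0 i j) ?aij // mul0r.
by rewrite weq mxE mul0r.
Qed.

End Graph.

(** Independent rigidity rows have a right inverse, so every prescription of edge rates is
    attained. *)
Lemma independent_velocity (R : realType) n (E : {set 'I_n * 'I_n})
    (p : 'M[R]_(n, 2)) (d : 'I_n * 'I_n -> R) : independent E p ->
  exists q, {in E, forall e, edge_form p q e = d e}.
Proof.
move=> /independentP/row_freeP[B MB].
exists (vec_mx (B *m \col_k d (enum_val k))^T) => e eE.
rewrite -[e in LHS](enum_rankK_in eE eE) -rigidity_mxE vec_mxK trmxK mulmxA MB.
by rewrite mul1mx mxE enum_rankK_in.
Qed.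

(** * Quadratic forms, centering and the full-rank completion *)

Section QuadraticForms.
Variable R : realType.

Definition quad n (X : 'M[R]_n) (v : 'rV[R]_n) := (v *m X *m v^T) 0 0.

Definition sqnorm n (v : 'rV[R]_n) := (v *m v^T) 0 0.

Lemma sqnormE n (v : 'rV[R]_n) : sqnorm v = \sum_i v 0 i ^+ 2.
Proof. by rewrite /sqnorm mxE; apply: eq_bigr => i _; rewrite mxE. Qed.

Lemma sqnorm_ge0 n (v : 'rV[R]_n) : 0 <= sqnorm v.
Proof. by rewrite sqnormE sumr_ge0 // => i _; apply: sqr_ge0. Qed.

Lemma cauchy_schwarz n (x y : 'I_n -> R) :
  (\sum_i x i * y i) ^+ 2 <= (\sum_i x i ^+ 2) * (\sum_i y i ^+ 2).
Proof.
(* Lagrange's identity: this double sum is twice the difference of the two sides. *)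
have : 0 <= \sum_i \sum_j (x i * y j - x j * y i) ^+ 2.
  by do 2!apply: sumr_ge0 => ? _; apply: sqr_ge0.
set a := \sum_i x i ^+ 2; set b := \sum_i y i ^+ 2; set c := \sum_i x i * y i.
rewrite (eq_bigr (fun i => x i ^+ 2 * b + y i ^+ 2 * a - (x i * y i) * (2 * c))).
  rewrite sumrB big_split /= -!mulr_suml -/a -/b -/c.
  by lra.
move=> i _; rewrite /a /b /c !mulr_sumr -big_split -sumrB.
by apply: eq_bigr => j _; rewrite /=; ring.
Qed.

Lemma sqnorm_mulmx n m (v : 'rV[R]_n) (q : 'M[R]_(n, m)) :
  sqnorm (v *m q) <= sqnorm v * \sum_k \sum_i q i k ^+ 2.
Proof.
rewrite sqnormE mulr_sumr; apply: ler_sum => k _; rewrite mxE sqnormE.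
exact: cauchy_schwarz.
Qed.

Definition centering n : 'M[R]_n := 1%:M - (n%:R^-1) *: const_mx 1.

Lemma mulmx_ones n (v : 'rV[R]_n) :
  v *m const_mx 1 = (\sum_i v 0 i) *: (const_mx 1 : 'rV_n).
Proof.
by apply/rowP=> j; rewrite !mxE mulr1; apply: eq_bigr => i _; rewrite mxE mulr1.
Qed.

Lemma centering_mul n (v : 'rV[R]_n) :
  v *m centering n = v - (n%:R^-1 * \sum_i v 0 i) *: const_mx 1.
Proof. by rewrite mulmxBr mulmx1 -scalemxAr mulmx_ones scalerA. Qed.

Lemma trmx_centering n : (centering n)^T = centering n.
Proof. by rewrite linearB linearZ /= trmx1 trmx_const. Qed.

Lemma centering_ones n : const_mx 1 *m centering n = 0 :> 'rV_n.
Proof.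
case: n => [|n]; first by apply/rowP; case.
rewrite centering_mul (eq_bigr (fun=> 1)) => [|i _]; last by rewrite mxE.
by rewrite sumr_const card_ord mulVf ?pnatr_eq0 // scale1r subrr.
Qed.

Lemma quad_centered n (Y : 'M[R]_n) v :
  quad (centering n *m Y *m centering n) v = quad Y (v *m centering n).
Proof. by rewrite /quad trmx_mul trmx_centering !mulmxA. Qed.

Lemma Kmap_quad n (X : 'M[R]_n) i j : X^T = X ->
  Kmap X i j = quad X (delta_mx 0 i - delta_mx 0 j).
Proof.
move=> sX; have Xji : X j i = X i j by rewrite -{1}sX mxE.
rewrite /quad linearB /= !trmx_delta mulmxBr !mulmxBl -!rowE -!colE !mxE Xji; ring.
Qed.

(** [Kmap] evaluates the quadratic form at differences of basis vectors, whose coordinates sum to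
    zero, so centering fixes them. *)
Lemma Kmap_centered n (Y : 'M[R]_n) i j : Y^T = Y ->
  Kmap (centering n *m Y *m centering n) i j = Kmap Y i j.
Proof.
move=> sY; have sX : (centering n *m Y *m centering n)^T = centering n *m Y *m centering n.
  by rewrite !trmx_mul trmx_centering sY mulmxA.
rewrite !Kmap_quad // quad_centered centering_mul; congr (quad _ _).
rewrite (eq_bigr (fun l => (l == i)%:R - (l == j)%:R)); last by move=> l _; rewrite !mxE !eqxx.
have one k : \sum_(l < n) (l == k)%:R = 1 :> R.
  by rewrite (bigD1 k) //= eqxx big1 ?addr0 // => l /negbTE->.
by rewrite sumrB !one subrr mulr0 scale0r subr0.
Qed.

(** Coercivity lets [quad X v] vanish only when centering kills [v], so the kernel of [X] is the
    line of the all-ones vector. *)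
Lemma centered_feasible n (Y : 'M[R]_n) (c : R) : 0 < c -> Y^T = Y ->
  (forall v, c * sqnorm v <= quad Y v) ->
  let X := centering n *m Y *m centering n in
  [/\ psd X, X *m const_mx 1 = 0 :> 'cV_n & \rank X = n.-1].
Proof.
move=> c0 sY coer X.
have sX : X^T = X by rewrite !trmx_mul trmx_centering sY mulmxA.
have qX v : c * sqnorm (v *m centering n) <= quad X v by rewrite quad_centered.
have psdX : psd X.
  split=> // v; apply: le_trans (qX v).
  by rewrite mulr_ge0 ?sqnorm_ge0 // ltW.
have e0 : const_mx 1 *m X = 0 :> 'rV_n.
  by rewrite /X !mulmxA centering_ones !mul0mx.
split=> //.
  by rewrite -[LHS]trmxK trmx_mul trmx_const sX e0 trmx0.
have kerX : (kermx X :=: (const_mx 1 : 'rV_n))%MS.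
  apply/eqmxP/andP; split; last by apply/sub_kermxP.
  apply/rV_subP=> v /sub_kermxP vX.
  have : c * sqnorm (v *m centering n) <= 0.
    by apply: le_trans (qX v) _; rewrite /quad vX mul0mx mxE.
  rewrite pmulr_rle0 // => s0.
  have /dotmx_eq0/eqP : sqnorm (v *m centering n) = 0.
    by apply/le_anti; rewrite s0 sqnorm_ge0.
  by rewrite centering_mul subr_eq0 => /eqP->; apply: scalemx_sub.
have := mxrank_ker X; rewrite kerX rank_rV; have := rank_leq_row X.
(* For [n = 0] the all-ones vector is zero and the claim reads [0 = 0.-1]. *)
move: (\rank X) => r; case: n {Y sY coer X sX qX psdX e0 kerX} => [|n]; first by lia.
have -> : (const_mx 1 : 'rV[R]_n.+1) != 0.
  by apply/negP=> /eqP/rowP/(_ 0)/eqP; rewrite !mxE oner_eq0.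
by move=> /=; lia.
Qed.

Section Lift.
Variables (n : nat) (p q : 'M[R]_(n, 2)) (eps : R).

Definition lifted_gram : 'M[R]_n :=
  p *m p^T + eps *: (p *m q^T + q *m p^T) + eps%:M.

Lemma lifted_gram_sym : lifted_gram^T = lifted_gram.
Proof.
have trD (A B : 'M[R]_n) : (A + B)^T = A^T + B^T by rewrite linearD.
rewrite /lifted_gram !trD linearZ /= trD !trmx_mul !trmxK tr_scalar_mx.
by rewrite [q *m _ + _]addrC.
Qed.

Lemma quad_lifted_gram v : quad lifted_gram v =
  sqnorm (v *m p + eps *: (v *m q)) + eps * sqnorm v - eps ^+ 2 * sqnorm (v *m q).
Proof.
rewrite /quad /sqnorm /lifted_gram.
have -> : v *m (p *m p^T + eps *: (p *m q^T + q *m p^T) + eps%:M) *m v^T =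
   v *m p *m (v *m p)^T + eps *: (v *m p *m (v *m q)^T + v *m q *m (v *m p)^T)
   + eps *: (v *m v^T).
  by rewrite !mulmxDr !mulmxDl -!scalemxAr -!scalemxAl !mulmxDr !mulmxDl
     !trmx_mul !mulmxA mul_mx_scalar -scalemxAl.
move: (v *m p) (v *m q) => a b.
have -> : (a + eps *: b)^T = a^T + eps *: b^T by rewrite linearD linearZ.
rewrite mulmxDl !mulmxDr -!scalemxAr -!scalemxAl.
move: (a *m a^T) (a *m b^T) (b *m a^T) (b *m b^T) (v *m v^T) => x1 x2 x3 x4 x5.
by rewrite !mxE; ring.
Qed.

(** Between distinct points the isotropic term adds [2 * eps]. No [eps ^+ 2] appears because
    [lifted_gram] omits the term in [q *m q^T]. *)
Lemma Kmap_lifted_gram i j : i != j ->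
  Kmap lifted_gram i j = sqdist p i j + 2 * eps * (edge_form p q (i, j) + 1).
Proof.
move=> ij; rewrite (_ : sqdist p i j = edge_form p p (i, j)); last first.
  by apply: eq_bigr => k _; rewrite expr2.
have mE (A B : 'M[R]_(n, 2)) k l : (A *m B^T) k l = A k 0 * B l 0 + A k 1 * B l 1.
  rewrite mxE !big_ord_recl big_ord0 addr0 !mxE.
  by rewrite (_ : lift ord0 ord0 = 1) //; apply: val_inj.
have YE k l : lifted_gram k l = (p *m p^T) k l
    + eps * ((p *m q^T) k l + (q *m p^T) k l) + eps *+ (k == l).
  by rewrite /lifted_gram; move: (p *m p^T) (p *m q^T) (q *m p^T) => A B D; rewrite !mxE.
by rewrite mxE !YE !mE !edge_formE !eqxx (negbTE ij) mulr1n mulr0n; ring.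
Qed.

End Lift.

(* To first order, moving along q shortens every edge by exactly what the
   isotropic term eps I adds; what is left of the isotropic term after
   completing the square is coercive for small eps. *)
Lemma full_rank_completion n (adj : rel 'I_n) (p : 'M[R]_(n, 2)) :
  simple_graph adj -> independent (edge_set adj) p ->
  exists X : 'M[R]_n, edm_feasible adj p X /\ \rank X = n.-1.
Proof.
move=> sadj ind; have [q qE] := independent_velocity (fun=> -1) ind.
pose C := \sum_k \sum_i q i k ^+ 2.
have C0 : 0 <= C by do 2!apply: sumr_ge0 => ? _; apply: sqr_ge0.
(* Then [eps * C <= 1/2], so the negative term costs at most half of [eps * sqnorm v]; adding 1
   keeps the denominator positive when [q = 0]. *)
pose eps := (2 * (C + 1))^-1.
have eps0 : 0 < eps by rewrite invr_gt0; lra.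
have epsC : eps * C <= 2^-1.
  have : eps * (2 * (C + 1)) = 1 by rewrite mulVf //; lra.
  by rewrite mulrDr mulrDr; lra.
have sY := lifted_gram_sym p q eps.
have coer v : eps / 2 * sqnorm v <= quad (lifted_gram p q eps) v.
  rewrite quad_lifted_gram.
  have h1 := sqnorm_mulmx v q; have h2 := sqnorm_ge0 (v *m p + eps *: (v *m q)).
  have h3 := sqnorm_ge0 v; rewrite -/C in h1.
  have h4 : eps ^+ 2 * sqnorm (v *m q) <= eps * (2^-1 * sqnorm v).
    rewrite expr2 -mulrA ler_pM2l //.
    apply: (@le_trans _ _ (eps * (sqnorm v * C))); first by rewrite ler_pM2l.
    by rewrite mulrCA mulrC ler_wpM2r.
  lra.
have c0 : 0 < eps / 2 by lra.
have [psdX Xe rX] := centered_feasible c0 sY coer.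
exists (centering n *m lifted_gram p q eps *m centering n).
split=> //; split=> // i j aij.
rewrite Kmap_centered // Kmap_lifted_gram; last first.
  by apply: contraTneq aij => ->; case: sadj => _; apply.
suff -> : edge_form p q (i, j) = -1 by rewrite addNr mulr0 addr0.
by case: (adj_edge_set sadj aij) => /qE <- //; rewrite edge_form_swap.
Qed.

End QuadraticForms.

Theorem mainTheorem9 (R : realType) (n : nat) (adj : rel 'I_n)
    (p : 'M[R]_(n, 2)) :
  simple_graph adj -> laman_sparse adj -> generic p ->
  (forall w : 'I_n -> 'I_n -> R,
      equilibrium_stress adj p w -> psd (stress_matrix w) ->
      stress_matrix w = 0) /\
  (exists X : 'M[R]_n, edm_feasible adj p X /\ \rank X = n.-1).
Proof.
move=> sadj lam gp.
have ind : independent (edge_set adj) p.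
  by apply: sparse_independent gp; [apply: edge_set_loopless|apply: edge_set_sparse].
split; last exact: full_rank_completion.
move=> w eqw _; have ssw := ind _ (equilibrium_self_stress sadj eqw).
have [wsym w0 _] := eqw.
(* [edge_set] stores each edge in one orientation; symmetry of [w] gives the other. *)
have wz i j : w i j = 0.
  case aij: (adj i j); last by rewrite w0 ?aij.
  by case: (adj_edge_set sadj aij) => /ssw //=; rewrite wsym.
apply/matrixP=> i j; rewrite !mxE; case: eqP => _; last by rewrite wz oppr0.
by rewrite big1.
Qed.
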